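(* Let $\lesssim$ be a quasiorder on a set $U$. (a) If $m$ is a minimal element of $(U,\lesssim)$, then ${\approx}(m)={\uparrow}m$ and ${\uparrow}m$ is a block of $\approx$. (b) If $(U,\lesssim)$ is bounded by minimal elements, then $\mathcal{H}=\{{\uparrow}m\mid m\text{ is a minimal element of }(U,\lesssim)\}$ is an irredundant covering of $U$, and the tolerance induced by $\mathcal{H}$ is $\approx$.
   Context: A quasiorder is a reflexive and transitive binary relation. In a quasiordered set $(U,\lesssim)$, an element $x$ is minimal if $y\lesssim x$ implies $x\lesssim y$; $(U,\lesssim)$ is bounded by minimal elements if for every $x\in U$ there is a minimal $m\in U$ with $m\lesssim x$. Write ${\uparrow}x=\{y\in U\mid x\lesssim y\}$. The relation $\approx$ is the product ${\gtrsim}\circ{\lesssim}$: $x\approx y$ if and only if there is $a\in U$ with $a\lesssim x$ and $a\lesssim y$; it is a tolerance (a reflexive and symmetric relation) on $U$, and ${\approx}(x)=\{y\in U\mid x\approx y\}$. For a tolerance $R$ on $U$, a nonempty $X\subseteq U$ is an $R$-preblock if $X\times X\subseteq R$; a block of $R$ is an $R$-preblock maximal with respect to inclusion. A covering of $U$ is a collection $\mathcal{H}$ of nonempty subsets of $U$ with $\bigcup\mathcal{H}=U$; it is irredundant if $\mathcal{H}\setminus\{X\}$ is not a covering of $U$ for any $X\in\mathcal{H}$. The tolerance induced by a covering $\mathcal{H}$ is $\bigcup\{X\times X\mid X\in\mathcal{H}\}$. *)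

(* Defs.v *)
From mathcomp Require Import all_boot.
From mathcomp Require Import boolp classical_sets.

Set Implicit Arguments.
Unset Strict Implicit.
Unset Printing Implicit Defensive.

Local Open Scope classical_set_scope.
Local Open Scope relation_scope.

(* A binary relation on U is a subset of U * U, and x R y is R (x, y). *)

Definition quasiorder (U : Type) (R : set (U * U)) : Prop :=
  (forall x, R (x, x)) /\ (forall x y z, R (x, y) -> R (y, z) -> R (x, z)).

Definition tolerance (U : Type) (R : set (U * U)) : Prop :=
  (forall x, R (x, x)) /\ (forall x y, R (x, y) -> R (y, x)).

Definition minimal (U : Type) (le : set (U * U)) (x : U) : Prop :=
  forall y, le (y, x) -> le (x, y).

Definition bounded_by_minimal (U : Type) (le : set (U * U)) : Prop :=
  forall x, exists2 m, minimal le m & le (m, x).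

(* [section R x] is R(x); for a quasiorder it is the up-set of x. *)
Definition section (U : Type) (R : set (U * U)) (x : U) : set U :=
  [set y | R (x, y)].

(* Pitfall: [B \; A] relates x to y when A (x, z) and B (z, y) for some z, so
   its right factor acts first. The product "le^-1 and then le" is thus
   [le \; le^-1]; see [approxP]. *)
Definition approx (U : Type) (le : set (U * U)) : set (U * U) := le \; le^-1.

Definition preblock (U : Type) (R : set (U * U)) (X : set U) : Prop :=
  X !=set0 /\ X `*` X `<=` R.

Definition block (U : Type) (R : set (U * U)) (X : set U) : Prop :=
  preblock R X /\ (forall Y, preblock R Y -> X `<=` Y -> Y = X).

Definition covering (U : Type) (H : set (set U)) : Prop :=
  (forall X, H X -> X !=set0) /\ \bigcup_(X in H) X = setT.

Definition irredundant_covering (U : Type) (H : set (set U)) : Prop :=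
  covering H /\ (forall X, H X -> ~ covering (H `\ X)).

Definition induced_tolerance (U : Type) (H : set (set U)) : set (U * U) :=
  \bigcup_(X in H) (X `*` X).

Lemma approxP (U : Type) (le : set (U * U)) (x y : U) :
  approx le (x, y) <-> exists a, le (a, x) /\ le (a, y).
Proof. by split=> [[a ax ay]|[a [ax ay]]]; exists a. Qed.

Lemma approx_tolerance (U : Type) (le : set (U * U)) :
  quasiorder le -> tolerance (approx le).
Proof.
move=> [le_refl _]; split=> [x|x y /approxP[a [ax ay]]].
  by apply/approxP; exists x; split; apply: le_refl.
by apply/approxP; exists a.
Qed.

Lemma induced_tolerance_tolerance (U : Type) (H : set (set U)) :
  covering H -> tolerance (induced_tolerance H).
Proof.
move=> [_ HT]; split=> [x|x y [X HX [/= Xx Xy]]]; last by exists X.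
have [X HX Xx] : (\bigcup_(X in H) X) x by rewrite HT.
by exists X.
Qed.

(* Main.v *)
Require Import Defs.
From mathcomp Require Import all_boot.
From mathcomp Require Import boolp classical_sets.

(** Everything rests on one remark: a witness [a] of [m ≈ y] lies below [m], so
    when [m] is minimal [m] also lies below [a], and hence below [y]. The
    [≈]-neighbourhood of a minimal [m] is therefore its up-set
    ([section_approx_minimal]). An up-set is always a preblock, having its
    generator as common lower bound, and no preblock containing [m] can leave
    the [≈]-neighbourhood of [m]; so the up-set of a minimal [m] is a block.

    When minimal elements bound the quasiorder, a common lower bound of [x] and
    [y] can be pushed down to a minimal one, so [x ≈ y] exactly when some
    minimal up-set contains both; this gives the induced tolerance. Each point
    lies in the up-set of a minimal element below it, whence the covering. For
    irredundancy, the minimal point [m] itself lies in no minimal up-set other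
    than its own ([section_minimal_eq]), so it is left uncovered when that
    up-set is removed. *)

Local Open Scope classical_set_scope.

Lemma section_approx_minimal (U : Type) (le : set (U * U)) (m : U) :
  quasiorder le -> minimal le m -> section (approx le) m = section le m.
Proof.
move=> [le_refl le_trans] m_min; apply/seteqP; split=> y.
  by move=> /approxP[a [am ay]]; apply: le_trans ay; apply: m_min.
by move=> my; apply/approxP; exists m; split=> //; apply: le_refl.
Qed.

Lemma preblock_section (U : Type) (le : set (U * U)) (x : U) :
  quasiorder le -> preblock (approx le) (section le x).
Proof.
move=> [le_refl _]; split; first by exists x; apply: le_refl.
by move=> [y z] [/= xy xz]; apply/approxP; exists x.
Qed.

Lemma block_section_minimal (U : Type) (le : set (U * U)) (m : U) :
  quasiorder le -> minimal le m -> block (approx le) (section le m).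
Proof.
move=> le_qo m_min; split=> [|Y [_ YY] mY]; first exact: preblock_section.
apply/seteqP; split=> // y Yy.
have Ym : Y m by apply: mY; apply: le_qo.1.
by rewrite -(section_approx_minimal U le m le_qo m_min); apply: YY.
Qed.

(** A minimal element is equivalent to everything below it, and equivalent
    elements have the same up-set. *)
Lemma section_minimal_eq (U : Type) (le : set (U * U)) (k m : U) :
  quasiorder le -> minimal le m -> le (k, m) -> section le k = section le m.
Proof.
move=> [_ le_trans] m_min km; apply/seteqP; split=> y; apply: le_trans => //.
exact: m_min.
Qed.

Lemma irredundant_covering_minimal (U : Type) (le : set (U * U)) :
  quasiorder le -> bounded_by_minimal le ->
  irredundant_covering [set X | exists2 m, minimal le m & X = section le m].
Proof.
move=> le_qo le_bd; split.
  split=> [X [m _ ->]|]; first by exists m; apply: le_qo.1.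
  apply/seteqP; split=> // x _; have [m m_min mx] := le_bd x.
  by exists (section le m) => //; exists m.
move=> X [m m_min ->] [_ H_cover].
have : [set: U] m by [].
rewrite -H_cover => -[Y [[k _ ->] neq_km] km].
by apply: neq_km; apply: section_minimal_eq.
Qed.

Lemma induced_tolerance_minimal (U : Type) (le : set (U * U)) :
  quasiorder le -> bounded_by_minimal le ->
  induced_tolerance [set X | exists2 m, minimal le m & X = section le m]
  = approx le.
Proof.
move=> le_qo le_bd; apply/seteqP; split=> -[x y].
  by move=> [X [m _ ->] xyX]; apply: (preblock_section U le m le_qo).2.
move=> /approxP[a [ax ay]]; have [m m_min ma] := le_bd a.
exists (section le m); first by exists m.
by split; [apply: le_qo.2 ax | apply: le_qo.2 ay].
Qed.

Theorem lemma3p1 (U : Type) (le : set (U * U)) (le_quasiorder : quasiorder le) :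
  (forall m : U, minimal le m ->
     section (approx le) m = section le m /\
     block (approx le) (section le m)) /\
  (bounded_by_minimal le ->
     let H := [set X : set U | exists2 m, minimal le m & X = section le m] in
     irredundant_covering H /\ induced_tolerance H = approx le).
Proof.
split=> [m m_min|le_bd H].
  by split; [apply: section_approx_minimal | apply: block_section_minimal].
by split; [apply: irredundant_covering_minimal
          | apply: induced_tolerance_minimal].
Qed.
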